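(* Let $q$ be a prime power, $2\le n\le m$ integers, $\mathcal{C}\le\mathbb{F}_q^{n\times m}$ an $\mathbb{F}_q$-linear subspace of dimension $k$ with dual $\mathcal{C}^\perp$, and $0\le i\le k$. For all $0\le u\le n$, $$B_u^{(i)}(\mathcal{C})=\sum_{j=0}^iq^{j(k-m(n-u)-i+j)}\begin{bmatrix} k-m(n-u) \\ i-j \end{bmatrix}_qB_{n-u}^{(j)}(\mathcal{C}^\perp).$$
   Context: The dual is $\mathcal{C}^\perp=\{N\in\mathbb{F}_q^{n\times m}:\operatorname{Tr}(MN^t)=0 \text{ for all } M\in\mathcal{C}\}$. For a subspace $\mathcal{D}\le\mathbb{F}_q^{n\times m}$ and $U\le\mathbb{F}_q^n$, $\mathcal{D}(U)=\{M\in\mathcal{D}:\operatorname{colsp}(M)\le U\}$, and, when $n=m$, $\mathcal{D}[U]=\{M\in\mathcal{D}:\operatorname{rowsp}(M)\le U\}$, where $\operatorname{colsp},\operatorname{rowsp}$ are column space and row space. $q$-binomial coefficient: for integers $a,b$, $\begin{bmatrix} a \\ b \end{bmatrix}_q$ is $0$ if $b<0$ or $0\le a<b$; $1$ if $b=0$; $\prod_{s=1}^b\frac{q^{a-s+1}-1}{q^s-1}$ if $b>0$ and $a\ge b$; and $(-1)^bq^{ab-\binom b2}\begin{bmatrix} -a+b-1 \\ b \end{bmatrix}_q$ if $b>0$ and $a<0$. Generalized binomial moments: for a subspace $\mathcal{D}\le\mathbb{F}_q^{n\times m}$, $0\le u\le n$ and an integer $j\ge0$, $$B_u^{(j)}(\mathcal{D})=\sum_{U\le\mathbb{F}_q^n,\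 \dim U=u}\begin{bmatrix} \dim\mathcal{D}(U) \\ j \end{bmatrix}_q\ \text{ if } n<m,\qquad B_u^{(j)}(\mathcal{D})=\frac12\sum_{U\le\mathbb{F}_q^n,\ \dim U=u}\left(\begin{bmatrix} \dim\mathcal{D}(U) \\ j \end{bmatrix}_q+\begin{bmatrix} \dim\mathcal{D}[U] \\ j \end{bmatrix}_q\right)\ \text{ if } n=m.$$ *)

(* Defs.v *)
From HB Require Import structures.
From mathcomp Require Import all_boot all_order all_algebra all_field.

Set Implicit Arguments.
Unset Strict Implicit.
Unset Printing Implicit Defensive.

Import Order.TTheory GRing.Theory Num.Theory VectorInternalTheory.
Local Open Scope ring_scope.

HB.instance Definition _ (F : finFieldType) (vT : vectType F) :=
  [Countable of {vspace vT} by <:].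
HB.instance Definition _ (F : finFieldType) (vT : vectType F) :=
  [Finite of {vspace vT} by <:].

(* The span of the elements satisfying P. Below it is only applied to
   predicates closed under linear combinations, for which it has exactly
   the elements satisfying P (mem_vspace_of_pred). *)
Definition vspace_of_pred (F : finFieldType) (m n : nat)
    (P : pred 'M[F]_(m, n)) : {vspace 'M[F]_(m, n)} :=
  <<enum P>>%VS.

Lemma mem_vspace_of_pred (F : finFieldType) (m n : nat)
    (P : pred 'M[F]_(m, n)) (M : 'M[F]_(m, n)) :
  P 0 -> (forall (a : F) X Y, P X -> P Y -> P (a *: X + Y)) ->
  (M \in vspace_of_pred P) = P M.
Proof.
move=> P0 Plin; apply/idP/idP=> [|PM]; last by rewrite memv_span ?mem_enum.
have sumP (I : Type) (r : seq I) (c : I -> F) (f : I -> 'M[F]_(m, n)) :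
  (forall i, P (f i)) -> P (\sum_(i <- r) c i *: f i).
  by move=> Pf; elim: r => [|x r IHr]; rewrite ?big_nil // big_cons Plin.
move=> /(@coord_span _ _ _ (in_tuple (enum P))) ->.
apply: sumP => i.
suff: (in_tuple (enum P))`_i \in enum P by rewrite mem_enum.
by rewrite mem_nth.
Qed.

(* Vectors of F^n are represented as row vectors, also for column spaces, so
   that the column space and the row space of a square matrix can be compared
   with the same subspace U. *)
Definition rowsp (F : finFieldType) (n m : nat) (M : 'M[F]_(n, m)) :
    {vspace 'rV[F]_m} :=
  <<[seq row i M | i : 'I_n]>>%VS.

Definition colsp (F : finFieldType) (n m : nat) (M : 'M[F]_(n, m)) :
    {vspace 'rV[F]_n} :=
  <<[seq (col j M)^T | j : 'I_m]>>%VS.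

Lemma rowsp_subP (F : finFieldType) (n m : nat) (M : 'M[F]_(n, m))
    (U : {vspace 'rV[F]_m}) :
  reflect (forall i, row i M \in U) (rowsp M <= U)%VS.
Proof.
apply: (iffP span_subvP) => [sMU i|sMU _ /mapP[i _ ->]]; last exact: sMU.
by apply: sMU; apply: map_f; rewrite mem_enum.
Qed.

Lemma colsp_subP (F : finFieldType) (n m : nat) (M : 'M[F]_(n, m))
    (U : {vspace 'rV[F]_n}) :
  reflect (forall j, (col j M)^T \in U) (colsp M <= U)%VS.
Proof.
apply: (iffP span_subvP) => [sMU i|sMU _ /mapP[i _ ->]]; last exact: sMU.
by apply: sMU; apply: map_f; rewrite mem_enum.
Qed.

Definition dual (F : finFieldType) (n m : nat) (C : {vspace 'M[F]_(n, m)}) :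
    {vspace 'M[F]_(n, m)} :=
  vspace_of_pred [pred N | [forall M in C, \tr (M *m N^T) == 0]].

Lemma mem_dualP (F : finFieldType) (n m : nat) (C : {vspace 'M[F]_(n, m)})
    (N : 'M[F]_(n, m)) :
  reflect (forall M, M \in C -> \tr (M *m N^T) = 0) (N \in dual C).
Proof.
rewrite mem_vspace_of_pred => [|/=|a X Y /= /eqfun_inP X0 /eqfun_inP Y0].
- exact: eqfun_inP.
- by apply/eqfun_inP=> M _; rewrite trmx0 mulmx0 mxtrace0.
apply/eqfun_inP=> M CM.
by rewrite linearP mulmxDr -scalemxAr mxtraceD mxtraceZ X0 // Y0 // mulr0 addr0.
Qed.

(* D(U) *)
Definition colshorten (F : finFieldType) (n m : nat)
    (D : {vspace 'M[F]_(n, m)}) (U : {vspace 'rV[F]_n}) :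
    {vspace 'M[F]_(n, m)} :=
  vspace_of_pred [pred M | (M \in D) && (colsp M <= U)%VS].

(* D[U] *)
Definition rowshorten (F : finFieldType) (n m : nat)
    (D : {vspace 'M[F]_(n, m)}) (U : {vspace 'rV[F]_m}) :
    {vspace 'M[F]_(n, m)} :=
  vspace_of_pred [pred M | (M \in D) && (rowsp M <= U)%VS].

Lemma mem_colshorten (F : finFieldType) (n m : nat)
    (D : {vspace 'M[F]_(n, m)}) (U : {vspace 'rV[F]_n}) (M : 'M[F]_(n, m)) :
  (M \in colshorten D U) = (M \in D) && (colsp M <= U)%VS.
Proof.
rewrite mem_vspace_of_pred //=; first rewrite mem0v /=.
  by apply/colsp_subP=> j; rewrite linear0 trmx0 mem0v.
move=> a X Y /andP[DX /colsp_subP UX] /andP[DY /colsp_subP UY].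
rewrite memvD ?memvZ //=; apply/colsp_subP=> j.
by rewrite !linearP /= memvD ?memvZ.
Qed.

Lemma mem_rowshorten (F : finFieldType) (n m : nat)
    (D : {vspace 'M[F]_(n, m)}) (U : {vspace 'rV[F]_m}) (M : 'M[F]_(n, m)) :
  (M \in rowshorten D U) = (M \in D) && (rowsp M <= U)%VS.
Proof.
rewrite mem_vspace_of_pred //=; first rewrite mem0v /=.
  by apply/rowsp_subP=> j; rewrite linear0 mem0v.
move=> a X Y /andP[DX /rowsp_subP UX] /andP[DY /rowsp_subP UY].
rewrite memvD ?memvZ //=; apply/rowsp_subP=> j.
by rewrite !linearP /= memvD ?memvZ.
Qed.

Definition qbinom_prod (q : nat) (a : int) (b : nat) : rat :=
  \prod_(1 <= s < b.+1) ((q%:R ^ (a - s%:Z + 1) - 1) / (q%:R ^+ s - 1)).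

(* In the last branch b > 0 and a < 0, so - a + b - 1 >= b and the recursive
   q-binomial coefficient of the usual definition is again a plain product. *)
Definition qbinom (q : nat) (a b : int) : rat :=
  if (b < 0) || (0 <= a < b) then 0
  else if b == 0 then 1
  else if b <= a then qbinom_prod q a `|b|%N
  else (-1) ^ b * q%:R ^ (a * b - 'C(`|b|%N, 2)%:Z)
       * qbinom_prod q (- a + b - 1) `|b|%N.

(* The notion is meant for n <= m. The equality test provides the proof
   e : n = m needed to see U <= F^n as a subspace of F^m in D[U]. *)
Definition binmoment (F : finFieldType) (n m : nat) (u j : nat)
    (D : {vspace 'M[F]_(n, m)}) : rat :=
  match @eqP nat n m with
  | ReflectT e =>
      2^-1 * \sum_(U : {vspace 'rV[F]_n} | \dim U == u)
        (qbinom #|F| (\dim (colshorten D U))%:Z j%:Z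
         + qbinom #|F|
             (\dim (rowshorten D (ecast l {vspace 'rV[F]_l} e U)))%:Z j%:Z)
  | ReflectF _ =>
      \sum_(U : {vspace 'rV[F]_n} | \dim U == u)
        qbinom #|F| (\dim (colshorten D U))%:Z j%:Z
  end.

(* Main.v *)
(** If [dim U = u], the orthogonal of the space of matrices with column space
    in [U] is the space of matrices with column space in [dual U]; hence
    [dim C(U) = (k - m (n - u)) + dim (dual C)(dual U)], and likewise for row
    spaces after transposition. Expanding the q-binomial coefficient of this
    sum by the q-Vandermonde identity, which holds with a possibly negative
    first summand, and summing over [U] gives the formula, because
    [U |-> dual U] is a bijection from the subspaces of dimension [u] onto
    those of dimension [n - u]. *)
Require Import Defs.
From HB Require Import structures.
From mathcomp Require Import all_boot all_order all_algebra all_field.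
From mathcomp Require Import ring zify.
Import Order.TTheory GRing.Theory Num.Theory.
Local Open Scope ring_scope.

(** * Gaussian binomials with integer upper argument, up to the q-Vandermonde identity *)

Section QBinomial.

Variable q : nat.
Hypothesis q_gt1 : (1 < q)%N.

Local Notation Q := (q%:R : rat).

Lemma qnat_neq0 : Q != 0.
Proof. by rewrite pnatr_eq0; lia. Qed.

Lemma qpow_sub1_neq0 (s : nat) : Q ^+ s.+1 - 1 != 0.
Proof.
by rewrite subr_eq0 -natrX pnatr_eq1 -(expn0 q) eqn_exp2l.
Qed.

Lemma qbinom_prod0 (a : int) : qbinom_prod q a 0 = 1.
Proof. by rewrite /qbinom_prod big_geq. Qed.

Lemma qbinom_prodS (a : int) (b : nat) :
  qbinom_prod q a b.+1 =
  qbinom_prod q a b * ((Q ^ (a - b%:Z) - 1) / (Q ^+ b.+1 - 1)).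
Proof.
rewrite /qbinom_prod big_nat_recr //=; congr (_ * ((Q ^ _ - 1) / _)).
by lia.
Qed.

(** Raising [a] by one shifts the numerator factors, leaving one new factor in front. With
    [qbinom_prodS] this makes each term of the two Pascal rules below a multiple of
    [qbinom_prod q a b]. *)
Lemma qbinom_prod_absorb (a : int) (b : nat) :
  qbinom_prod q (a + 1) b.+1 =
  qbinom_prod q a b * ((Q ^ (a + 1) - 1) / (Q ^+ b.+1 - 1)).
Proof.
elim: b => [|b IHb]; first by rewrite qbinom_prodS !qbinom_prod0 subr0.
rewrite qbinom_prodS IHb (qbinom_prodS a b).
have -> : a + 1 - b.+1%:Z = a - b%:Z by lia.
by ring.
Qed.

Lemma qbinom_prod_pascal_l (a : int) (b : nat) :
  qbinom_prod q (a + 1) b.+1 =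
  Q ^+ b.+1 * qbinom_prod q a b.+1 + qbinom_prod q a b.
Proof.
rewrite qbinom_prod_absorb qbinom_prodS.
have -> : Q ^ (a + 1) = Q ^+ b.+1 * Q ^ (a - b%:Z).
  by rewrite exprnP -expfzDr ?qnat_neq0 //; congr (_ ^ _); lia.
by have := qpow_sub1_neq0 b; move: (Q ^+ b.+1) => x x1; field.
Qed.

Lemma qbinom_prod_pascal_r (a : int) (b : nat) :
  qbinom_prod q (a + 1) b.+1 =
  qbinom_prod q a b.+1 + Q ^ (a - b%:Z) * qbinom_prod q a b.
Proof.
rewrite qbinom_prod_absorb qbinom_prodS.
have -> : Q ^ (a + 1) = Q ^+ b.+1 * Q ^ (a - b%:Z).
  by rewrite exprnP -expfzDr ?qnat_neq0 //; congr (_ ^ _); lia.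
by have := qpow_sub1_neq0 b; move: (Q ^+ b.+1) => x x1; field.
Qed.

(** The numerator factor with [s = a + 1] vanishes. *)
Lemma qbinom_prod_eq0 (a b : nat) : (a < b)%N -> qbinom_prod q a b = 0.
Proof.
elim: b => // b IHb; rewrite ltnS leq_eqVlt qbinom_prodS => /predU1P[-> | /IHb->].
  by rewrite subrr subrr mul0r mulr0.
by rewrite mul0r.
Qed.

(** Read backwards, the numerator on the right has the opposite exponents of the one on the left;
    each pair of factors differs by [- Q ^ x], with [x] running over [a, ..., a - b + 1]. *)
Lemma qbinom_prodN (a : int) (b : nat) :
  qbinom_prod q a b =
  (-1) ^+ b * Q ^ (a * b%:Z - 'C(b, 2)%:Z) * qbinom_prod q (- a + b%:Z - 1) b.
Proof.
rewrite /qbinom_prod !prodf_div mulrA; congr (_ / _).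
rewrite [in RHS]big_nat_rev /=.
under [in RHS]eq_big_nat => s sb.
  have -> : - a + b%:Z - 1 - (1 + b.+1 - s.+1)%N%:Z + 1 = - a + s%:Z - 1 by lia.
  over.
elim: b => [|b IHb]; first by rewrite !big_geq // mulr0 subr0 expr0z !mulr1.
rewrite !(big_nat_recr b.+1) //= IHb exprS.
have -> : a * b.+1%:Z - 'C(b.+1, 2)%:Z = (a * b%:Z - 'C(b, 2)%:Z) + (a - b%:Z).
  by rewrite binS bin1; lia.
rewrite [in RHS]expfzDr ?qnat_neq0 //.
have -> : a - b.+1%:Z + 1 = a - b%:Z by lia.
have -> : - a + b.+1%:Z - 1 = - (a - b%:Z) by lia.
rewrite -invr_expz.
have: Q ^ (a - b%:Z) != 0 by rewrite expfz_neq0 ?qnat_neq0.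
by move: (Q ^ (a - b%:Z)) => x x0; field.
Qed.

(** Removes all case distinctions on the sign of [a] from what follows. *)
Lemma qbinomE (a : int) (b : nat) : qbinom q a b = qbinom_prod q a b.
Proof.
rewrite /qbinom /=; case: ifP => [ab|ab].
  by case: a ab => // a ab; rewrite qbinom_prod_eq0.
case: ifP => [/eqP [->]|_]; first by rewrite qbinom_prod0.
by case: ifP => // _; rewrite [RHS]qbinom_prodN.
Qed.

(** Induction on [b], moving one unit from [b] to [a]: one Pascal rule expands the factor in
    [a + 1], the other reassembles the factor in [b.+1]. *)
Lemma qbinom_prod_Vandermonde (a : int) (b i : nat) :
  qbinom_prod q (a + b%:Z) i =
  \sum_(0 <= j < i.+1) Q ^ (j%:Z * (a - i%:Z + j%:Z))
     * qbinom_prod q a (i - j) * qbinom_prod q b j.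
Proof.
elim: b a i => [|b IHb] a i.
  rewrite addr0 big_nat_recl // qbinom_prod0 subn0 mul0r expr0z mul1r mulr1.
  by rewrite big1 ?addr0 // => j _; rewrite [qbinom_prod q 0%N _]qbinom_prod_eq0 ?mulr0.
have -> : a + b.+1%:Z = a + 1 + b%:Z by lia.
rewrite IHb; case: i => [|i].
  by rewrite !big_nat1 !qbinom_prod0 !mul0r.
(* Each term with [j <= i] splits in two; the term [j = i.+1] has lower index [0] and stays
   whole. *)
have -> : \sum_(0 <= j < i.+2) Q ^ (j%:Z * (a + 1 - i.+1%:Z + j%:Z))
     * qbinom_prod q (a + 1) (i.+1 - j) * qbinom_prod q b j =
  \sum_(0 <= j < i.+2) Q ^ (j%:Z * (a + 1 - i.+1%:Z + j%:Z))
     * qbinom_prod q a (i.+1 - j) * qbinom_prod q b j +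
  \sum_(0 <= j < i.+1) Q ^ (j.+1%:Z * (a - i.+1%:Z + j.+1%:Z))
     * qbinom_prod q a (i - j) * qbinom_prod q b j.
  rewrite !(big_nat_recr i.+1) //= subnn !qbinom_prod0 [in RHS]addrAC -big_split /=.
  congr (_ + _); apply: eq_big_nat => j /andP[_ ji].
  rewrite subSn ?qbinom_prod_pascal_r; last by lia.
  have -> : j.+1%:Z * (a - i.+1%:Z + j.+1%:Z) =
     j%:Z * (a + 1 - i.+1%:Z + j%:Z) + (a - (i - j)%N%:Z).
    by rewrite -subzn //; lia.
  by rewrite [in RHS]expfzDr ?qnat_neq0 //; ring.
(* The terms [j = 0] agree; shifting the first sum by one aligns it with the second. *)
rewrite !(big_nat_recl i.+1) //= -addrA -big_split /= !qbinom_prod0 !mul0r.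
congr (_ + _); apply: eq_big_nat => j /andP[_ ji].
have -> : Posz b.+1 = b%:Z + 1 by lia.
rewrite subSS qbinom_prod_pascal_l.
have -> : j.+1%:Z * (a + 1 - i.+1%:Z + j.+1%:Z) =
   j.+1%:Z * (a - i.+1%:Z + j.+1%:Z) + j.+1%:Z by lia.
by rewrite expfzDr ?qnat_neq0 // -exprnP; ring.
Qed.

End QBinomial.

(** * Trace duality and the dimensions of shortened codes *)

Section Duality.

Set Implicit Arguments.
Unset Strict Implicit.

Variable F : finFieldType.

Lemma dimv_matrix (n m : nat) : \dim (fullv : {vspace 'M[F]_(n, m)}) = (n * m)%N.
Proof. by rewrite dimvf dim_matrix. Qed.

(** Rank-nullity for the map sending [N] to its trace pairings with a basis of [C]; its kernel is
    [dual C]. *)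
Lemma dim_dual_ge (n m : nat) (C : {vspace 'M[F]_(n, m)}) :
  (n * m <= \dim (dual C) + \dim C)%N.
Proof.
pose f (N : 'M[F]_(n, m)) : 'rV[F]_(\dim C) :=
  \row_i \tr ((vbasis C)`_i *m N^T).
have f_lin : linear f.
  move=> a X Y; apply/rowP=> i.
  by rewrite !mxE linearP mulmxDr -scalemxAr mxtraceD mxtraceZ.
pose fL := GRing.isLinear.Build F _ _ _ f f_lin.
pose g : {linear 'M[F]_(n, m) -> 'rV[F]_(\dim C)} := HB.pack f fL.
have <- : lker (linfun g) = dual C.
  apply/vspaceP=> N; rewrite memv_ker lfunE /=; apply/eqP/mem_dualP => [fN M CM|NC].
    rewrite (coord_vbasis CM) mulmx_suml raddf_sum big1 //= => j _.
    rewrite -scalemxAl mxtraceZ.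
    by move/rowP/(_ j): fN; rewrite !mxE => ->; rewrite mulr0.
  apply/rowP=> j; rewrite !mxE; apply: NC.
  by rewrite vbasis_mem // mem_nth ?size_tuple.
have := limg_ker_dim (linfun g) fullv; rewrite capfv dimv_matrix => <-.
by rewrite leq_add2l (leq_trans (dimvS (subvf _))) // dimv_matrix mul1n.
Qed.

Lemma dualD (n m : nat) (C D : {vspace 'M[F]_(n, m)}) :
  dual (C + D) = (dual C :&: dual D)%VS.
Proof.
apply/vspaceP=> N; rewrite memv_cap; apply/mem_dualP/andP => [N_CD|[NC ND]].
  by split; apply/mem_dualP=> M MC; apply: N_CD; apply: subvP MC;
    rewrite ?addvSl ?addvSr.
move=> _ /memv_addP[X XC [Y YD ->]].
by rewrite mulmxDl mxtraceD (mem_dualP _ _ NC) // (mem_dualP _ _ ND) // addr0.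
Qed.

Lemma dual_fullv (n m : nat) : dual (fullv : {vspace 'M[F]_(n, m)}) = 0%VS.
Proof.
apply/eqP; rewrite -subv0; apply/subvP=> N /mem_dualP N0; rewrite memv0.
(* Pairing with [delta_mx i j] reads off the entry [N i j]. *)
apply/eqP/matrixP=> i j; rewrite mxE -(N0 (delta_mx i j) (memvf _)).
rewrite /mxtrace (bigD1 i) //= mxE (bigD1 j) //= !mxE !eqxx mul1r.
rewrite !big1 ?addr0 // => [l /negPf li|l /negPf lj].
  by rewrite mxE big1 // => k _; rewrite !mxE li mul0r.
by rewrite !mxE lj andbF mul0r.
Qed.

(* [dim_dual_ge] for both [C] and a complement of [C] forces equality, since the
   two duals meet trivially. *)
Lemma dim_dual (n m : nat) (C : {vspace 'M[F]_(n, m)}) :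
  (\dim (dual C) + \dim C)%N = (n * m)%N.
Proof.
have := dimv_sum_cap (dual C) (dual C^C).
rewrite -dualD addv_complf dual_fullv dimv0 addn0.
have := dimvS (subvf (dual C + dual C^C)%VS).
have := dim_dual_ge C; have := dim_dual_ge C^C.
by rewrite dimv_compl dimv_matrix; have := dimvS (subvf C);
  rewrite dimv_matrix; lia.
Qed.

Lemma dualK (n m : nat) : involutive (@dual F n m).
Proof.
move=> C; apply/esym/eqP; rewrite eqEdim.
have := dim_dual C; have := dim_dual (dual C) => d1 d2.
apply/andP; split; last by lia.
apply/subvP=> M MC; apply/mem_dualP=> N /mem_dualP/(_ M MC) <-.
by rewrite -mxtrace_tr trmx_mul trmxK.
Qed.

Lemma rowshortenE (n m : nat) (D : {vspace 'M[F]_(n, m)}) U :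
  rowshorten D U = (D :&: rowshorten fullv U)%VS.
Proof. by apply/vspaceP=> M; rewrite memv_cap !mem_rowshorten memvf. Qed.

(** If the rows of [A] form a basis of [U], then [X |-> X *m A] is injective with this space as
    image. *)
Lemma dim_rowshorten_fullv (n m : nat) (U : {vspace 'rV[F]_m}) :
  \dim (rowshorten (fullv : {vspace 'M[F]_(n, m)}) U) = (n * \dim U)%N.
Proof.
pose A : 'M[F]_(\dim U, m) := \matrix_i (vbasis U)`_i.
have row_mulA (X : 'M[F]_(n, \dim U)) i :
    row i (X *m A) = \sum_j X i j *: (vbasis U)`_j.
  rewrite row_mul mulmx_sum_row; apply: eq_bigr => j _.
  by rewrite mxE rowK.
have A_inj : (fullv :&: lker (linfun (mulmxr A : {linear 'M[F]_(n, _) -> _})))%VS = 0%VS.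
  apply/eqP; rewrite capfv -subv0; apply/subvP=> X; rewrite memv_ker memv0 lfunE /=.
  move=> /eqP XA0; apply/eqP/matrixP=> i j; rewrite mxE.
  have /freeP free_b := basis_free (vbasisP U); apply: (free_b (X i)) => //.
  by rewrite -row_mulA XA0 linear0.
rewrite -(dimv_matrix n (\dim U)) -(limg_dim_eq A_inj).
congr (\dim _); apply/vspaceP=> M; rewrite mem_rowshorten memvf /=.
apply/rowsp_subP/memv_imgP => [MU|[X _ ->] i].
  exists (\matrix_(i, j) coord (vbasis U) j (row i M)); first exact: memvf.
  rewrite lfunE /=; apply/row_matrixP=> i; rewrite row_mulA {1}(coord_vbasis (MU i)).
  by apply: eq_bigr => j _; rewrite mxE.
rewrite lfunE /= row_mulA memv_suml // => j _; rewrite memvZ //.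
by rewrite vbasis_mem // mem_nth ?size_tuple.
Qed.

(* [dual U] is the dual of [U] seen as a space of 1 x m matrices: the trace form
   is then the standard dot product. *)
Lemma dual_rowshorten_fullv (n m : nat) (U : {vspace 'rV[F]_m}) :
  dual (rowshorten (fullv : {vspace 'M[F]_(n, m)}) U) = rowshorten fullv (dual U).
Proof.
apply/esym/eqP; rewrite eqEdim; apply/andP; split; last first.
  have := dim_dual (rowshorten (fullv : {vspace 'M[F]_(n, m)}) U).
  by rewrite !dim_rowshorten_fullv; have := dim_dual U; nia.
apply/subvP=> N; rewrite mem_rowshorten memvf /= => /rowsp_subP NU.
apply/mem_dualP=> M; rewrite mem_rowshorten memvf /= => /rowsp_subP MU.
(* The [i]-th diagonal entry is the dot product of the [i]-th rows of [M] and [N]. *)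
rewrite /mxtrace big1 // => i _.
have /mem_dualP/(_ _ (MU i)) := NU i.
rewrite /mxtrace big_ord1 !mxE => E; rewrite -[RHS]E.
by apply: eq_bigr => j _; rewrite !mxE.
Qed.

(** With [R] the space of all matrices with row space in [U], the two shortenings are the
    intersection of [D] and [R] and the dual of [D + R]. *)
Lemma dim_rowshorten_dual (n m : nat) (D : {vspace 'M[F]_(n, m)}) U :
  (\dim (rowshorten D U) + n * (m - \dim U))%N =
  (\dim D + \dim (rowshorten (dual D) (dual U)))%N.
Proof.
rewrite (rowshortenE D) (rowshortenE (dual D)) -dual_rowshorten_fullv -dualD.
have := dim_dual (D + rowshorten fullv U)%VS.
have := dimv_sum_cap D (rowshorten fullv U).
have := dimvS (subvf U); rewrite dimv_matrix mul1n dim_rowshorten_fullv.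
rewrite mulnBr => dU; have : (n * \dim U <= n * m)%N by rewrite leq_mul2l dU orbT.
by move: (n * m)%N; lia.
Qed.

(** The transposed code, which reduces column shortenings to row shortenings. *)
Definition trmx_img (n m : nat) (D : {vspace 'M[F]_(n, m)}) :
    {vspace 'M[F]_(m, n)} :=
  (linfun (@trmx F n m) @: D)%VS.

Lemma mem_trmx_img (n m : nat) (D : {vspace 'M[F]_(n, m)}) M :
  (M \in trmx_img D) = (M^T \in D).
Proof.
apply/memv_imgP/idP => [[X XD ->]|MD]; first by rewrite lfunE trmxK.
by exists M^T; rewrite // lfunE /= trmxK.
Qed.

Lemma dim_trmx_img (n m : nat) (D : {vspace 'M[F]_(n, m)}) :
  \dim (trmx_img D) = \dim D.
Proof.
apply: limg_dim_eq; apply/eqP; rewrite -subv0; apply/subvP=> X.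
by rewrite memv_cap memv_ker lfunE memv0 /= trmx_eq0 => /andP[].
Qed.

Lemma dual_trmx_img (n m : nat) (D : {vspace 'M[F]_(n, m)}) :
  dual (trmx_img D) = trmx_img (dual D).
Proof.
apply/vspaceP=> N; rewrite mem_trmx_img.
apply/mem_dualP/mem_dualP => ND M MD.
  by rewrite trmxK -mxtrace_tr trmx_mul mxtrace_mulC ND ?mem_trmx_img ?trmxK.
rewrite mem_trmx_img in MD.
by rewrite -mxtrace_tr trmx_mul trmxK mxtrace_mulC -[X in _ *m X]trmxK ND.
Qed.

Lemma dim_colshorten (n m : nat) (D : {vspace 'M[F]_(n, m)}) U :
  \dim (colshorten D U) = \dim (rowshorten (trmx_img D) U).
Proof.
rewrite -(dim_trmx_img (colshorten D U)); congr (\dim _); apply/vspaceP=> M.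
rewrite mem_rowshorten !mem_trmx_img mem_colshorten; congr (_ && _).
by apply/colsp_subP/rowsp_subP=> MU i; have := MU i; rewrite tr_col trmxK.
Qed.

Lemma dim_colshorten_dual (n m : nat) (D : {vspace 'M[F]_(n, m)}) U :
  (\dim (colshorten D U) + m * (n - \dim U))%N =
  (\dim D + \dim (colshorten (dual D) (dual U)))%N.
Proof. by rewrite !dim_colshorten dim_rowshorten_dual dim_trmx_img dual_trmx_img. Qed.

End Duality.

(** * Summation over subspaces and the moment identity *)

Section BinomialMoments.

Set Implicit Arguments.
Unset Strict Implicit.

Variable F : finFieldType.

Lemma binmoment_square (n u j : nat) (D : {vspace 'M[F]_(n, n)}) :
  binmoment u j D =
  2^-1 * (\sum_(U : {vspace 'rV[F]_n} | \dim U == u)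
            qbinom #|F| (\dim (colshorten D U)) j
          + \sum_(U : {vspace 'rV[F]_n} | \dim U == u)
            qbinom #|F| (\dim (rowshorten D U)) j).
Proof.
(* Identity proofs on [nat] are unique, so the cast along [e : n = n] disappears. *)
by rewrite -big_split /binmoment; case: eqP => // e; rewrite (eq_axiomK e).
Qed.

Lemma binmoment_rect (n m u j : nat) (D : {vspace 'M[F]_(n, m)}) :
  n != m ->
  binmoment u j D =
  \sum_(U : {vspace 'rV[F]_n} | \dim U == u)
     qbinom #|F| (\dim (colshorten D U)) j.
Proof. by rewrite /binmoment; case: eqP. Qed.

(** Abstract [g] and [h] let one argument serve both column and row shortenings. *)
Lemma sum_qbinom_dual (n m k i u : nat) (g h : {vspace 'rV[F]_n} -> nat) :
  (u <= n)%N ->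
  (forall U, g U + m * (n - \dim U) = k + h (dual U))%N ->
  \sum_(U : {vspace 'rV[F]_n} | \dim U == u) qbinom #|F| (g U) i =
  \sum_(0 <= j < i.+1)
     (#|F|%:R : rat)
       ^ (j%:Z * (k%:Z - m%:Z * (n%:Z - u%:Z) - i%:Z + j%:Z))
     * qbinom #|F| (k%:Z - m%:Z * (n%:Z - u%:Z)) (i%:Z - j%:Z)
     * \sum_(U : {vspace 'rV[F]_n} | \dim U == (n - u)%N) qbinom #|F| (h U) j.
Proof.
move=> un gh; have q_gt1 := card_finNzRing_gt1 F.
under [RHS]eq_bigr => j _ do
  rewrite (reindex_inj (inv_inj (@dualK F 1 n))) big_distrr /=.
rewrite [RHS](exchange_big_dep (fun U : {vspace 'rV[F]_n} => \dim U == u)) /=.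
  apply: eq_bigr => U /eqP dU.
  have dim_dualU : \dim (dual U) == (n - u)%N.
    by have := dim_dual U; rewrite dU; lia.
  have -> : (g U)%:Z = k%:Z - m%:Z * (n%:Z - u%:Z) + (h (dual U))%:Z.
    by have := gh U; rewrite dU; nia.
  rewrite qbinomE // qbinom_prod_Vandermonde //.
  under [RHS]eq_bigl => j do rewrite dim_dualU.
  (* Since [j <= i], the integer [i - j] is a natural number and [qbinomE] applies. *)
  apply: eq_big_nat => j /andP[_ ji].
  by have -> : i%:Z - j%:Z = (i - j)%N%:Z by [rewrite subzn]; rewrite !qbinomE.
(* The swap of sums requires that [dual U] of dimension [n - u] forces [\dim U = u]. *)
by move=> j U _; have := dim_dual U; lia.
Qed.

End BinomialMoments.

Theorem theorem7p1 (F : finFieldType) (n m k i u : nat)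
    (C : {vspace 'M[F]_(n, m)})
    (hn : (2 <= n)%N) (hnm : (n <= m)%N) (hk : \dim C = k)
    (hi : (i <= k)%N) (hu : (u <= n)%N) :
  binmoment u i C =
  \sum_(0 <= j < i.+1)
     (#|F|%:R : rat)
       ^ (j%:Z * (k%:Z - m%:Z * (n%:Z - u%:Z) - i%:Z + j%:Z))
     * qbinom #|F| (k%:Z - m%:Z * (n%:Z - u%:Z)) (i%:Z - j%:Z)
     * binmoment (n - u) j (dual C).
Proof.
have col_eq := sum_qbinom_dual (h := fun U => \dim (colshorten (dual C) U)) i hu
  (dim_colshorten_dual C).
have [nm|nm] := eqVneq n m; last first.
  rewrite binmoment_rect // col_eq hk.
  by apply: eq_bigr => j _; rewrite binmoment_rect.
subst m.
(* For square matrices the row sums satisfy the identity with the same coefficients, so the average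
   does too. *)
have row_eq := sum_qbinom_dual (h := fun U => \dim (rowshorten (dual C) U)) i hu
  (dim_rowshorten_dual C).
rewrite binmoment_square col_eq row_eq hk -big_split big_distrr /=.
apply: eq_bigr => j _; rewrite binmoment_square.
by rewrite -mulrDr mulrCA.
Qed.
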